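(* (i) Every chordal graph $G$ satisfies $\omega_1(G)\le \chi_1(G)\le \left\lceil \frac{\chi(G)}{2}\right\rceil$. (ii) For every integer $k\ge 2$ there exists an interval graph $G_k$ with $\omega(G_k)=\chi(G_k)=k$ and $\omega_1(G_k)=\chi_1(G_k)=\left\lceil \frac{k}{2}\right\rceil$.
   Context: All graphs are finite and simple. A 1-selection of a graph $G=(V,E)$ is a map $f$ assigning to each vertex $v$ a set $f(v)$ of at most one edge incident with $v$. The 1-removed subgraph $G_f$ has vertex set $V$ and edge set $E\setminus\bigcup_{v\in V}f(v)$. The robust chromatic number is $\chi_1(G)=\min_f\chi(G_f)$ and the robust clique number is $\omega_1(G)=\min_f\omega(G_f)$, minima over all 1-selections $f$ of $G$. A graph is chordal if it has no induced cycle of length greater than 3; an interval graph is the intersection graph of a family of intervals of the real line. *)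

(* Defs.v *)
From mathcomp Require Import all_boot all_order all_algebra.
From mathcomp Require Import reals.

Set Implicit Arguments.
Unset Strict Implicit.
Unset Printing Implicit Defensive.

Record sgraph := SGraph {
  vertex :> finType;
  edge : rel vertex;
  edge_sym : symmetric edge;
  edge_irr : irreflexive edge }.

Arguments edge {s} : rename.

Definition edges (G : sgraph) : {set {set G}} :=
  [set [set p.1; p.2] | p : G * G & edge p.1 p.2].

Definition clique (G : sgraph) (A : {set G}) : bool :=
  [forall x in A, forall y in A, (x != y) ==> edge x y].

Definition omega (G : sgraph) : nat := \max_(A : {set G} | clique A) #|A|.

Definition proper_coloring (G : sgraph) (k : nat) (c : {ffun G -> 'I_k}) : bool :=
  [forall x, forall y, edge x y ==> (c x != c y)].

Definition colorable (G : sgraph) (k : nat) : bool :=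
  [exists c : {ffun G -> 'I_k}, proper_coloring c].

Lemma ex_colorable (G : sgraph) : exists k, colorable G k.
Proof.
exists #|G|; apply/existsP; exists [ffun x => enum_rank x].
apply/forallP => x; apply/forallP => y; apply/implyP => xy; rewrite !ffunE.
by apply: contraTneq xy => /enum_rank_inj ->; rewrite edge_irr.
Qed.

Definition chi (G : sgraph) : nat := ex_minn (ex_colorable G).

Definition is_selection (G : sgraph) (f : {ffun G -> {set {set G}}}) : bool :=
  [forall v, (#|f v| <= 1) && (f v \subset [set e in edges G | v \in e])].

Definition empty_selection (G : sgraph) : {ffun G -> {set {set G}}} :=
  [ffun=> set0].

Lemma empty_selectionP (G : sgraph) : is_selection (empty_selection G).
Proof. by apply/forallP => v; rewrite ffunE cards0 sub0set. Qed.

Section Removed.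
Variables (G : sgraph) (f : {ffun G -> {set {set G}}}).

Definition removed_edge : rel G :=
  [rel x y | edge x y && ([set x; y] \notin \bigcup_v f v)].

Lemma removed_edge_sym : symmetric removed_edge.
Proof. by move=> x y; rewrite /removed_edge /= edge_sym setUC. Qed.

Lemma removed_edge_irr : irreflexive removed_edge.
Proof. by move=> x; rewrite /removed_edge /= edge_irr. Qed.

Definition removed : sgraph := SGraph removed_edge_sym removed_edge_irr.

Lemma edges_removed : edges removed = edges G :\: \bigcup_v f v.
Proof.
apply/setP => e; rewrite inE; apply/imsetP/andP.
  case=> -[x y]; rewrite inE /= => /andP[xy nf] ->; split=> //.
  by apply/imsetP; exists (x, y); rewrite ?inE.
case=> nf /imsetP[[x y]]; rewrite inE /= => xy def_e.
exists (x, y); last exact: def_e.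
by rewrite inE; apply/andP; split; [exact: xy | rewrite -[X in X \notin _]def_e].
Qed.

End Removed.

(* [arg min] is meaningful because [empty_selectionP] makes the default
   argument admissible. *)
Definition chi1 (G : sgraph) : nat :=
  chi (removed [arg min_(f < empty_selection G | is_selection f)
                  chi (removed f)]).

Definition omega1 (G : sgraph) : nat :=
  omega (removed [arg min_(f < empty_selection G | is_selection f)
                    omega (removed f)]).

(* A cycle of [G], listed in cyclic order, with no chord. *)
Definition induced_cycle (G : sgraph) (s : seq G) : Prop :=
  [/\ 2 < size s, ucycle edge s &
      {in s &, forall x y, edge x y -> y = next s x \/ x = next s y}].

Definition chordal (G : sgraph) : Prop :=
  forall s : seq G, induced_cycle s -> size s <= 3.

(* [interval R] has all kinds of endpoints (open, closed, infinite) but also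
   contains empty intervals, which are excluded here. *)
Definition interval_graph (R : realType) (G : sgraph) : Prop :=
  exists I : G -> interval R,
    (forall x, exists t : R, t \in I x) /\
    (forall x y, edge x y <->
       x != y /\ exists t : R, (t \in I x) && (t \in I y)).

(* Main.v *)
(** (i) In a proper colouring of a chordal graph, two colour classes induce a
    forest; pairing up the classes and letting each vertex select the edge to
    its parent in its own forest merges each pair into one independent set.

    (ii) [G_k] is the comparability graph of the complete [k]-ary tree with [k]
    levels, an interval graph of nested and disjoint intervals. Given a
    selection, a root-to-leaf branch can be grown so that no vertex of it
    selects an edge to a lower vertex of it. The edges removed inside this
    [k]-clique then all point upwards, one per vertex at most, so they form a
    forest, and the larger class of a 2-colouring of that forest is a surviving
    clique of size at least [k / 2]. *)

Require Import Defs.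
From mathcomp Require Import all_boot all_order all_algebra.
From mathcomp Require Import reals.
From mathcomp Require Import zify.

Set Implicit Arguments.
Unset Strict Implicit.
Unset Printing Implicit Defensive.

(** * General bounds on the chromatic, clique and robust numbers *)

Lemma chi_le (G : sgraph) (k : nat) : colorable G k -> chi G <= k.
Proof. by rewrite /chi; case: ex_minnP => m _; apply. Qed.

Lemma chi_colorable (G : sgraph) : colorable G (chi G).
Proof. by rewrite /chi; case: ex_minnP. Qed.

Lemma leq_clique_omega (G : sgraph) (A : {set G}) : clique A -> #|A| <= omega G.
Proof. by move=> cA; rewrite /omega (bigmax_sup A). Qed.

Lemma leq_clique_colors (G : sgraph) (A : {set G}) (k : nat) :
  clique A -> colorable G k -> #|A| <= k.
Proof.
move=> /forall_inP cA /existsP[c /forallP cP].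
rewrite -[k]card_ord -(card_in_imset (f := c) (D := mem A)) ?max_card //.
move=> x y xA yA cxy; apply/eqP/negPn/negP => xy.
have /forall_inP/(_ y yA)/implyP/(_ xy) exy := cA x xA.
by have /forallP/(_ y)/implyP/(_ exy)/eqP := cP x.
Qed.

Lemma omega_le_chi (G : sgraph) : omega G <= chi G.
Proof.
by apply/bigmax_leqP => A cA; apply: leq_clique_colors (chi_colorable G).
Qed.

Lemma chi1_le_removed (G : sgraph) f :
  is_selection (G := G) f -> chi1 G <= chi (removed f).
Proof.
by rewrite /chi1; case: arg_minnP => [|g _]; [exact: empty_selectionP | apply].
Qed.

Lemma omega1_le_chi1 (G : sgraph) : omega1 G <= chi1 G.
Proof.
rewrite /chi1; case: arg_minnP => [|f sf _]; first exact: empty_selectionP.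
apply: leq_trans (omega_le_chi _); rewrite /omega1.
by case: arg_minnP => [|g _]; [exact: empty_selectionP | apply].
Qed.

Lemma leq_omega1 (G : sgraph) (m : nat) :
  (forall f, is_selection (G := G) f -> m <= omega (removed f)) -> m <= omega1 G.
Proof.
move=> le_m; rewrite /omega1; case: arg_minnP => [|g sg _].
  exact: empty_selectionP.
exact: le_m.
Qed.

(** Source of both upper bounds on [chi1]: if each [v] selects its edge to [par v], when there is
    one, all monochromatic edges disappear and [c] becomes proper. *)
Lemma chi1_le_parent (G : sgraph) (k : nat) (c : G -> nat) (par : G -> G) :
  (forall v, c v < k) ->
  (forall u v, edge u v -> c u = c v -> par u = v \/ par v = u) ->
  chi1 G <= k.
Proof.
move=> ck cP.
pose f := [ffun v : G => if edge v (par v) then [set [set v; par v]] else set0].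
have sf : is_selection f.
  apply/forallP => v; rewrite ffunE; case: ifP => ev; last first.
    by rewrite cards0 sub0set.
  rewrite cards1 sub1set inE set21 andbT.
  by apply/imsetP; exists (v, par v); rewrite ?inE.
apply: leq_trans (chi1_le_removed sf) (chi_le _).
apply/existsP; exists [ffun v => Ordinal (ck v)].
apply/forallP => u; apply/forallP => v; apply/implyP => /andP[euv nf].
rewrite !ffunE; apply: contra nf => /eqP[cuv].
have [par_u | par_v] := cP u v euv cuv; apply/bigcupP.
  by exists u => //; rewrite ffunE par_u euv inE.
by exists v => //; rewrite ffunE par_v edge_sym euv inE setUC.
Qed.

(** * Chordal graphs: forests induced by two colour classes *)

(** By symmetry, adjacency need only be checked at positions [i < j], where the sole wrap-around
    pair is [0] and [n.-1]. *)
Lemma induced_cycleI (G : sgraph) (x0 : G) (s : seq G) (n : nat) :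
  size s = n -> 2 < n -> uniq s ->
  (forall i j, i < j < n -> edge (nth x0 s i) (nth x0 s j) =
     (j == i.+1) || (i == 0) && (j == n.-1)) ->
  induced_cycle s.
Proof.
move=> sz n_gt2 s_uniq sE.
have nextE i : i < n ->
    next s (nth x0 s i) = nth x0 s (if i.+1 == n then 0 else i.+1).
  rewrite -sz => lti; rewrite next_nth mem_nth // index_uniq //.
  case: s {sz s_uniq sE} lti => //= y p lti.
  rewrite eqSS; case: eqP => [->|ne_i]; first by rewrite nth_default.
  by apply: set_nth_default; lia.
split; first by rewrite sz.
  rewrite /ucycle s_uniq andbT; apply: cycle_from_next => // _ /(nthP x0)[i + <-].
  rewrite sz => lti; rewrite nextE //; case: eqP => [eq_i|ne_i]; last first.
    by rewrite sE ?eqxx //; lia.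
  by rewrite edge_sym sE; lia.
move=> _ _ /(nthP x0)[i + <-] /(nthP x0)[j + <-]; rewrite sz => lti ltj.
rewrite !nextE //.
wlog ltij : i j lti ltj / i < j.
  move=> th; have [|ltji|->] := ltngtP i j; first exact: th.
    by rewrite edge_sym => /th-/(_ ltj lti ltji)[]; [right | left].
  by rewrite edge_irr.
rewrite sE ?ltij // => /orP[/eqP eq_j|/andP[/eqP-> /eqP eq_j]].
  by left; rewrite -eq_j; case: eqP => //; lia.
by right; case: eqP => //; lia.
Qed.

(* The end of a longest induced path is a leaf: a further neighbour of it would
   close an induced cycle, which is neither a triangle (two colours) nor
   longer (chordality). *)
Lemma chordal_bipartite_leaf (G : sgraph) (S : {set G}) (b : G -> bool) :
  chordal G -> {in S &, forall u v, edge u v -> b u != b v} -> S != set0 ->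
  exists v w, v \in S /\ {in S, forall u, edge v u -> u = w}.
Proof.
move=> chG bP /set0Pn[x0 x0S].
case: (boolP [exists v in S, exists w, forall u in S, edge v u ==> (u == w)]).
  move=> /exists_inP[v vS /existsP[w /forall_inP wP]].
  by exists v, w; split=> // u uS; move/implyP: (wP u uS) => uw /uw/eqP.
move=> /exists_inPn no_leaf.
pose indpath (s : seq G) := [/\ uniq s, {subset s <= S} & forall i j,
  i < j < size s -> edge (nth x0 s i) (nth x0 s j) = (j == i.+1)].
have extend x s : indpath (x :: s) -> exists y, indpath [:: y, x & s].
  move=> [xs_uniq xsS xsE]; have xS := xsS x (mem_head _ _).
  (* The vertex to avoid is the successor of [x] on the path, or [x] itself when the path is a
     single vertex. *)
  have /existsPn/(_ (head x s))/forall_inPn[y yS] := no_leaf x xS.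
  rewrite negb_imply => /andP[exy y_neq].
  have y_notin : y \notin x :: s.
    apply: contra y_neq => /(nthP x0)[[|i] lti yE].
      by rewrite -yE /= edge_irr in exy.
    have := xsE 0 i.+1 lti; rewrite yE exy => /esym/eqP[i0].
    by move: yE lti; rewrite i0; case: s {xs_uniq xsS xsE i0} => //= ? ? ->.
  exists y; have [hasy|nhasy] := boolP (has (edge y) s); last first.
    split; first by rewrite cons_uniq y_notin.
      by move=> z; rewrite inE => /predU1P[->|/xsS].
    move=> [|i] [|j] //=; last exact: xsE.
    case: j => [|j] ltj; first by rewrite edge_sym exy.
    by rewrite (negbTE (hasPn nhasy _ (mem_nth _ _))).
  (* The first neighbour of [y] on [s] closes a chordless cycle of length [j + 3]; chordality forces
     [j = 0], and the resulting triangle contradicts the 2-colouring [b]. *)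
  set j := find (edge y) s; have ltj : j < size s by rewrite -has_find.
  have tE i : i < j.+2 ->
      nth x0 (y :: take j.+2 (x :: s)) i.+1 = nth x0 (x :: s) i.
    by move=> lti; rewrite -(nth_take x0 lti).
  have cyc : induced_cycle (y :: take j.+2 (x :: s)).
    apply: (@induced_cycleI _ x0 _ j.+3) => [|||a c] //; first by rewrite /= size_takel.
      by rewrite cons_uniq take_uniq // (contra (@mem_take _ _ _ _)).
    case: c => [|c] // /andP[ltac ltc]; rewrite tE //.
    case: a ltac => [|a] ltac; last first.
      by rewrite tE ?xsE /=; lia.
    case: c {ltac} ltc => [|c] ltc; first by rewrite edge_sym exy.
    rewrite /=; have [->|ne_cj] := eqVneq c j; first by rewrite nth_find // eqxx.
    by rewrite before_find -/j; lia.
  have j0 : j = 0 by have := chG _ cyc; rewrite /= size_takel; lia.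
  have eyz : edge y (nth x0 s 0) by rewrite -j0 nth_find.
  have exz : edge x (nth x0 s 0) by have /= -> := xsE 0 1 (leq_ltn_trans (leq0n j) ltj).
  have zS : nth x0 s 0 \in S by rewrite xsS // inE mem_nth ?orbT // -j0.
  move: (bP _ _ xS yS exy) (bP _ _ yS zS eyz) (bP _ _ xS zS exz).
  by case: (b x); case: (b y); case: (b _).
(* Without a leaf, induced paths grow forever; one with [#|G| + 1] distinct vertices is absurd. *)
have longpath n : exists x s, indpath (x :: s) /\ size s = n.
  elim: n => [|n [x [s [/extend[y yP] <-]]]]; last by exists y, (x :: s).
  exists x0, [::]; do 2!split=> //; first by move=> z; rewrite inE => /eqP->.
  by move=> i [|j]; rewrite ?ltn0 ?andbF.
have [x [s [[xs_uniq _ _] sz]]] := longpath #|G|.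
by have := max_card (mem (x :: s)); rewrite (card_uniqP xs_uniq) /= sz ltnn.
Qed.

(** Leaves are peeled off one at a time: a leaf takes its only possible neighbour as parent, and the
    other vertices keep the parents found in the rest. *)
Lemma chordal_bipartite_parent (G : sgraph) (S : {set G}) (b : G -> bool) :
  chordal G -> {in S &, forall u v, edge u v -> b u != b v} ->
  exists par : G -> G, {in S &, forall u v, edge u v -> par u = v \/ par v = u}.
Proof.
move=> chG; elim: {S}_.+1 {-2}S (ltnSn #|S|) => // n IHn S leSn bP.
have [->|/(chordal_bipartite_leaf chG bP)[v [w [vS wP]]]] := eqVneq S set0.
  by exists id => u w; rewrite inE.
have [||par parP] := IHn (S :\ v); first by move: leSn; rewrite (cardsD1 v) vS.
  by move=> x y /setD1P[_ xS] /setD1P[_ yS]; apply: bP.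
exists (fun u => if u == v then w else par u) => x y xS yS exy.
have [eq_xv|ne_xv] := eqVneq x v.
  by left; rewrite (wP y) // -eq_xv.
have [eq_yv|ne_yv] := eqVneq y v; last by apply: parP => //; rewrite !inE ?ne_xv ?ne_yv.
by right; rewrite (wP x) // -eq_yv edge_sym.
Qed.

Lemma chordal_chi1 (G : sgraph) : chordal G -> chi1 G <= uphalf (chi G).
Proof.
move=> chG; have /existsP[c /forallP cP] := chi_colorable G.
have /fin_all_exists[par parP] (m : 'I_(uphalf (chi G))) : exists par : G -> G,
    {in [set v : G | (c v)./2 == m] &, forall u v,
      edge u v -> par u = v \/ par v = u}.
  (* Colours [2m] and [2m + 1] form the pair [m], so parity is a proper 2-colouring inside each
     pair. *)
  apply: (chordal_bipartite_parent (b := fun v => odd (c v)) chG) => u v.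
  rewrite !inE => /eqP cu /eqP cv euv.
  have /forallP/(_ v)/implyP/(_ euv) := cP u; apply: contra => /eqP ouv.
  by rewrite -val_eqE /= -[c u : nat]odd_double_half -[c v : nat]odd_double_half ouv cu cv.
have ck v : (c v)./2 < uphalf (chi G) by have := ltn_ord (c v); lia.
apply: (@chi1_le_parent _ _ (fun v => (c v)./2) (fun v => par (Ordinal (ck v)) v)).
  exact: ck.
move=> u v euv cuv.
have -> : Ordinal (ck v) = Ordinal (ck u) by apply: val_inj.
by apply: parP => //; rewrite inE //= cuv.
Qed.

(** * Cliques surviving a selection *)

Lemma selection_mem (G : sgraph) f (v : G) e :
  is_selection f -> e \in f v -> v \in e.
Proof. by move=> /forallP/(_ v)/andP[_ /subsetP fv] /fv; rewrite inE => /andP[]. Qed.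

Lemma selection_eq (G : sgraph) f (v : G) e e' :
  is_selection f -> e \in f v -> e' \in f v -> e = e'.
Proof. by move=> /forallP/(_ v)/andP[/card_le1_eqP fv _] he he'; exact: fv he' he. Qed.

Lemma set2_inj (T : finType) (x y y' : T) :
  y != x -> [set x; y] = [set x; y'] -> y = y'.
Proof. by move=> yx /setP/(_ y); rewrite !inE eqxx orbT (negbTE yx) => /esym/eqP. Qed.

(** Greedy colouring in increasing order: each [j] has at most one earlier [r]-neighbour whose
    colour it must avoid. *)
Lemma backward_2coloring (r : rel nat) (n : nat) :
  (forall i i' j, i < j < n -> i' < j -> r i j -> r i' j -> i = i') ->
  exists c : nat -> bool, forall i j, i < j < n -> r i j -> c i != c j.
Proof.
elim: n => [|n IHn] r1; first by exists xpredT => i j; rewrite ltn0 andbF.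
have [|c cP] := IHn; first by move=> i i' j /andP[ij jn]; apply: r1; rewrite ij ltnW.
have [/existsP[m rm]|no_m] := boolP [exists m : 'I_n, r m n].
  exists (fun j => if j == n then ~~ c m else c j) => i j /andP[ij].
  rewrite ltnS leq_eqVlt => /predU1P[eq_j|ltj] rij.
    rewrite eq_j in ij rij *; rewrite eqxx (ltn_eqF ij) (r1 i m n) ?ij //=.
    by case: (c m).
  by rewrite !ltn_eqF ?(ltn_trans ij) // cP ?ij.
exists c => i j /andP[ij]; rewrite ltnS leq_eqVlt => /predU1P[eq_j|ltj] rij.
  rewrite eq_j in ij rij; case/negP: no_m.
  by apply/existsP; exists (Ordinal ij).
by rewrite cP ?ij.
Qed.

(* The selections point backwards along [p], so the edges they remove among the
   [p i] form a forest; the larger class of a 2-colouring of it survives. *)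
Lemma half_clique_removed (G : sgraph) f (p : nat -> G) (n : nat) :
  is_selection f ->
  (forall i j, i < j < n -> edge (p i) (p j)) ->
  (forall i j, i < j < n -> [set p i; p j] \notin f (p i)) ->
  uphalf n <= omega (removed f).
Proof.
move=> sf pE pN.
have p_neq i j : i < j < n -> p i != p j.
  by move=> /pE; apply: contraTneq => ->; rewrite edge_irr.
have p_inj : {in gtn n &, injective p}.
  move=> i j; rewrite !inE => lti ltj eq_p; apply/eqP.
  have [ij|ji|//] := ltngtP i j; first by rewrite -(negbTE (p_neq i j _)) ?ij ?eq_p ?eqxx.
  by rewrite -(negbTE (p_neq j i _)) ?ji ?eq_p ?eqxx.
(* The relation says that the later end selects the edge; a vertex selects at most one edge, hence
   at most one earlier [i]. *)
have [|c cP] := @backward_2coloring (fun i j => [set p i; p j] \in f (p j)) n.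
  move=> i i' j ijn i'j fi fi'; have /andP[ij jn] := ijn.
  apply: p_inj; rewrite ?inE ?(ltn_trans _ jn) //.
  apply: (set2_inj (p_neq i j ijn)); rewrite ![[set p j; _]]setUC.
  exact: selection_eq fi fi'.
pose A b := [set p i | i : 'I_n & c i == b].
have cA b : #|A b| = #|[pred i : 'I_n | c i == b]|.
  rewrite card_in_imset; first by apply: eq_card => i; rewrite inE.
  by move=> i j _ _ /p_inj eq_ij; apply: val_inj; apply: eq_ij; rewrite inE.
have sum_A : #|A true| + #|A false| = n.
  rewrite !cA -[RHS]card_ord -(cardC [pred i : 'I_n | c i == true]).
  by congr (_ + _); apply: eq_card => i; rewrite !inE; case: (c i).
suff clA b : clique (A b : {set removed f}).
  have leA b : #|A b| <= omega (removed f) := leq_clique_omega (clA b).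
  by have := leA true; have := leA false; lia.
have clA_lt i j : i < j < n -> c i = c j -> edge (p i : removed f) (p j).
  move=> ijn cij; rewrite /edge /= /removed_edge /= pE //=.
  apply/bigcupP => -[v _ fv].
  (* A removed edge is selected by one of its ends: the earlier one is excluded by [pN], the later
     one by the equality of colours. *)
  have := selection_mem sf fv; rewrite !inE => /pred2P[eq_v|eq_v]; rewrite eq_v in fv.
    by rewrite (negbTE (pN i j ijn)) in fv.
  by have := cP i j ijn fv; rewrite cij eqxx.
apply/forall_inP => _ /imsetP[i + ->]; rewrite inE => /eqP ci.
apply/forall_inP => _ /imsetP[j + ->]; rewrite inE => /eqP cj.
apply/implyP => pij; have [ij|ji|eq_ij] := ltngtP i j.
- by apply: clA_lt; rewrite ?ij ?ltn_ord ?ci ?cj.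
- by rewrite edge_sym; apply: clA_lt; rewrite ?ji ?ltn_ord ?ci ?cj.
- by rewrite eq_ij eqxx in pij.
Qed.

(** * The comparability graph of a complete tree *)

Section Tree.
Variables (T : finType) (K : nat).

(** A node is encoded by the word of child choices leading to it from the root, so ancestry is the
    prefix order and there are [K.+1] levels. *)
Definition comparable_edge : rel (K.-bseq T) :=
  fun s t => (s != t) && (prefix s t || prefix t s).

Lemma comparable_edge_sym : symmetric comparable_edge.
Proof. by move=> s t; rewrite /comparable_edge eq_sym orbC. Qed.

Lemma comparable_edge_irr : irreflexive comparable_edge.
Proof. by move=> s; rewrite /comparable_edge eqxx. Qed.

Definition tree : sgraph := SGraph comparable_edge_sym comparable_edge_irr.

Lemma size_tree_neq (s t : tree) : edge s t -> size s != size t.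
Proof.
case/andP=> neq_st pre; apply: contra neq_st => /eqP eq_sz; rewrite -val_eqE /=.
by move: pre; rewrite !prefixE -eq_sz take_size eq_sz take_size => /orP[] /eqP->.
Qed.

Lemma colorable_tree : colorable tree K.+1.
Proof.
have szK (s : tree) : size s < K.+1 by exact: size_bseq.
apply/existsP; exists [ffun s => Ordinal (szK s)].
apply/forallP => s; apply/forallP => t; apply/implyP => /size_tree_neq.
by rewrite !ffunE.
Qed.

(** Levels [2m] and [2m + 1] share a colour; comparable nodes in them are parent and child, and the
    parent is obtained by deleting the last letter. *)
Lemma chi1_tree : chi1 tree <= uphalf K.+1.
Proof.
apply: (@chi1_le_parent _ _ (fun s : tree => (size s)./2)
          (fun s : tree => [bseq of take (size s).-1 s])) => [s|].
  by have := size_bseq s; lia.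
have half s t : prefix s t -> size s != size t -> (size s)./2 = (size t)./2 ->
    take (size t).-1 t = s :> seq T.
  move=> st neq_sz eq_half; have := size_prefix st; move: (st).
  rewrite prefixE => /eqP {2}<- _; congr (take _ _).
  by have := size_prefix st; lia.
move=> s t st eq_half; have neq_sz := size_tree_neq st; case/andP: st => _.
case/orP => pre; [right | left]; apply: val_inj; apply: half => //.
by rewrite eq_sym.
Qed.

(* Meaningful for [size s <= K] only: longer prefixes become the empty sequence. *)
Definition branch (s : seq T) (i : nat) : tree := insub_bseq K (take i s).

Lemma branchE (s : seq T) (i : nat) : size s <= K -> branch s i = take i s :> seq T.
Proof.
move=> sK; apply: insubdK; rewrite unfold_in; apply: leq_trans sK.
by rewrite size_take_min geq_minr.
Qed.

Lemma branch_edge (s : seq T) (i j : nat) :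
  size s <= K -> i < j <= size s -> edge (branch s i) (branch s j).
Proof.
move=> sK /andP[ij js]; apply/andP; split.
  rewrite -val_eqE /= !branchE //; apply/eqP => /(congr1 size).
  by rewrite !size_takel ?(leq_trans (ltnW ij)) // => eq_ij; rewrite eq_ij ltnn in ij.
by rewrite !branchE // -(take_takel _ (ltnW ij)) prefix_take.
Qed.

(* Each of the at most [K] vertices on the branch built so far forbids at most
   one of the more than [K] children of its end. *)
Lemma branch_avoiding f (n : nat) :
  K < #|T| -> is_selection (G := tree) f -> n <= K ->
  exists s : seq T, size s = n /\ forall i j, i < j <= n ->
    [set branch s i; branch s j] \notin f (branch s i).
Proof.
move=> KT sf; elim: n => [|n IHn] ltn; first by exists [::]; split=> // i j; lia.
have [s [sz sP]] := IHn (ltnW ltn).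
have szr a : size (rcons s a) <= K by rewrite size_rcons sz.
have branch_rcons a i : i <= n -> branch (rcons s a) i = branch s i.
  move=> le_in; apply: val_inj; rewrite /= !branchE ?sz ?(ltnW ltn) //.
  by rewrite -cats1 takel_cat ?sz.
have branch_last a : branch (rcons s a) n.+1 = rcons s a :> seq T.
  by rewrite branchE // take_oversize // size_rcons sz.
have [/existsP[a /forallP aP]|bad] := boolP [exists a, forall i : 'I_n.+1,
    [set branch s i; branch (rcons s a) n.+1] \notin f (branch s i)].
  exists (rcons s a); split=> [|i j]; first by rewrite size_rcons sz.
  rewrite [j <= _]leq_eqVlt => /andP[ij /predU1P[eq_j|]].
    rewrite eq_j in ij *; rewrite branch_rcons //; exact: (aP (Ordinal ij)).
  rewrite ltnS => le_jn; have le_in := leq_trans (ltnW ij) le_jn.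
  by rewrite !branch_rcons // sP // ij.
(* If every child is forbidden, [g] sends it to the depth of an ancestor forbidding it. One selected
   edge per ancestor makes [g] injective, so [#|T| <= n.+1 <= K], a contradiction. *)
have /fin_all_exists[g gP] a : exists i : 'I_n.+1,
    [set branch s i; branch (rcons s a) n.+1] \in f (branch s i).
  by move: bad; rewrite negb_exists => /forallP/(_ a)/forallPn[i /negPn]; exists i.
have g_inj : injective g.
  move=> a a' eq_g; have ga := gP a; have := gP a'; rewrite -eq_g => ga'.
  have neq : branch (rcons s a) n.+1 != branch s (g a).
    have : edge (branch (rcons s a) (g a)) (branch (rcons s a) n.+1).
      by apply: branch_edge; rewrite // size_rcons sz ltn_ord /=.
    rewrite branch_rcons -1?ltnS // eq_sym.
    by apply: contraTneq => ->; rewrite edge_irr.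
  have /(congr1 val) := set2_inj neq (selection_eq sf ga ga').
  by rewrite /= !branch_last => eq_r; apply: rcons_injr eq_r.
by have := leq_card g g_inj; rewrite card_ord; lia.
Qed.

Lemma omega_tree : 0 < #|T| -> omega tree = K.+1.
Proof.
move=> /card_gt0P[x0 _]; apply/eqP; rewrite eqn_leq; apply/andP; split.
  exact: leq_trans (omega_le_chi _) (chi_le colorable_tree).
(* Any root-to-leaf branch is a clique meeting all levels; a constant word provides one. *)
pose p (i : 'I_K.+1) := branch (nseq K x0) i.
have pE (i j : 'I_K.+1) : i < j -> edge (p i) (p j).
  by move=> ij; apply: branch_edge; rewrite size_nseq // ij -ltnS ltn_ord.
have p_inj : injective p.
  move=> i j eq_p; apply: val_inj; have [/pE|/pE|//] := ltngtP i j.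
    by rewrite eq_p edge_irr.
  by rewrite eq_p edge_irr.
have <- : #|[set p i | i : 'I_K.+1]| = K.+1 by rewrite card_imset ?card_ord.
apply: leq_clique_omega; apply/forall_inP => _ /imsetP[i _ ->].
apply/forall_inP => _ /imsetP[j _ ->]; apply/implyP.
have [/pE|/pE|/val_inj->] := ltngtP i j; rewrite ?eqxx //.
by rewrite edge_sym.
Qed.

Lemma chi_tree : 0 < #|T| -> chi tree = K.+1.
Proof.
move=> T0; apply/eqP; rewrite eqn_leq (chi_le colorable_tree).
by rewrite -{1}(omega_tree T0) omega_le_chi.
Qed.

Lemma omega1_tree : K < #|T| -> uphalf K.+1 <= omega1 tree.
Proof.
move=> KT; apply: leq_omega1 => f sf.
have [s [sz sP]] := branch_avoiding KT sf (leqnn K).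
apply: (@half_clique_removed tree f (branch s)) => // i j ij.
by apply: branch_edge; rewrite sz.
Qed.

End Tree.

(** * Interval representation of the tree *)

Section Intervals.
Variable N : nat.

(* In base [N], [s] is sent to the integers below [N ^ h] whose [h]-digit
   expansion starts with [s]. *)
Fixpoint tree_lo (h : nat) (s : seq 'I_N) : nat :=
  if s is x :: s' then x * N ^ h.-1 + tree_lo h.-1 s' else 0.

Definition tree_hi (h : nat) (s : seq 'I_N) : nat := tree_lo h s + N ^ (h - size s).

Lemma tree_hi_cons h x (s : seq 'I_N) :
  tree_hi h.+1 (x :: s) = x * N ^ h + tree_hi h s.
Proof. by rewrite /tree_hi /= subSS addnA. Qed.

Lemma tree_hi_le h (s : seq 'I_N) : size s <= h -> tree_hi h s <= N ^ h.
Proof.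
elim: s h => [|x s IHs] h; first by rewrite /tree_hi /= subn0.
case: h => // h; rewrite /= ltnS => le_sh.
rewrite tree_hi_cons expnS (leq_trans (leq_add (leqnn _) (IHs h le_sh))) //.
by rewrite addnC -mulSn leq_mul2r ltn_ord orbT.
Qed.

Lemma tree_lo_lt_hi h (s : seq 'I_N) : 0 < N -> tree_lo h s < tree_hi h s.
Proof. by move=> N0; rewrite /tree_hi -addn1 leq_add2l expn_gt0 N0. Qed.

(** The right-hand side says that two half-open blocks meet. The empty word has the full block, a
    common first digit shifts both blocks equally, and distinct first digits separate them. *)
Lemma prefix_tree_lo_hi h (s t : seq 'I_N) :
  0 < N -> size s <= h -> size t <= h ->
  prefix s t || prefix t s =
    (tree_lo h s < tree_hi h t) && (tree_lo h t < tree_hi h s).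
Proof.
move=> N0; have nilP h' u : size u <= h' ->
    (tree_lo h' [::] < tree_hi h' u) && (tree_lo h' u < tree_hi h' [::]).
  move=> le_uh; have lo_hi := tree_lo_lt_hi h' u N0.
  rewrite (leq_ltn_trans (leq0n _) lo_hi) (leq_trans lo_hi) //.
  by rewrite [leqRHS]/tree_hi /= subn0 tree_hi_le.
elim: s h t => [|x s IHs] h [|y t].
- by move=> /nilP->.
- by move=> _ /nilP->.
- by move=> /nilP; rewrite andbC => ->.
case: h => // h; rewrite !ltnS => les let_; rewrite !prefix_cons !tree_hi_cons /=.
have [<-|neq_xy] := eqVneq x y; first by rewrite !ltn_add2l -IHs.
have far (a b : 'I_N) u v : a < b -> size u <= h ->
    b * N ^ h + tree_lo h v < a * N ^ h + tree_hi h u = false.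
  move=> ab /tree_hi_le hi_u; apply/negbTE; rewrite -leqNgt.
  apply: leq_trans (leq_addr _ _); apply: leq_trans (_ : a.+1 * N ^ h <= _).
    by rewrite mulSn addnC leq_add2r.
  by rewrite leq_mul2r ab orbT.
have [xy|yx|/val_inj eq_xy] := ltngtP x y; first by rewrite (far x y) ?andbF.
  by rewrite (far y x).
by rewrite eq_xy eqxx in neq_xy.
Qed.

End Intervals.

Import Order.TTheory Num.Theory.

(** The intervals are half-open because those of consecutive siblings abut: closed ones would share
    an endpoint. *)
Lemma tree_interval_graph (R : realType) (N K : nat) :
  0 < N -> interval_graph R (tree 'I_N K).
Proof.
move=> N0; exists (fun s : tree 'I_N K =>
  `[(tree_lo K s)%:R, (tree_hi K s)%:R[%R); split=> [s|s t].
  by exists (tree_lo K s)%:R%R; rewrite in_itv /= lexx ltr_nat tree_lo_lt_hi.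
have [sK tK] := (size_bseq s, size_bseq t).
split=> [/andP[-> +]|[st [x /andP[]]]]; rewrite ?(prefix_tree_lo_hi N0 sK tK).
  (* The larger left end lies in both intervals. *)
  move=> /andP[lt_st lt_ts]; split=> //; exists (maxn (tree_lo K s) (tree_lo K t))%:R%R.
  by rewrite !in_itv /= !ler_nat !ltr_nat leq_maxl leq_maxr !gtn_max lt_st lt_ts !tree_lo_lt_hi.
rewrite !in_itv /= => /andP[sx xs] /andP[tx xt]; apply/andP; split=> //.
rewrite (prefix_tree_lo_hi N0 sK tK) -!(ltr_nat R).
by rewrite (le_lt_trans sx xt) (le_lt_trans tx xs).
Qed.

Theorem theorem1p2 :
  (forall G : sgraph, chordal G ->
     omega1 G <= chi1 G /\ chi1 G <= uphalf (chi G)) /\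
  (forall (R : realType) (k : nat), 2 <= k ->
     exists G : sgraph,
       [/\ interval_graph R G,
           omega G = k, chi G = k,
           omega1 G = uphalf k & chi1 G = uphalf k]).
Proof.
split=> [G chG|R [|K] // _].
  by split; [exact: omega1_le_chi1 | exact: chordal_chi1].
have cT : #|'I_K.+1| = K.+1 by rewrite card_ord.
(* With [k = K.+1], depth [K] gives [k] levels, and [k] children per inner node exceed the [K] that
   a branch can forbid. *)
exists (tree 'I_K.+1 K).
have ub := chi1_tree 'I_K.+1 K; have le := omega1_le_chi1 (tree 'I_K.+1 K).
have lb : uphalf K.+1 <= omega1 (tree 'I_K.+1 K) by apply: omega1_tree; rewrite cT.
split; [exact: tree_interval_graph | apply: omega_tree | apply: chi_tree | |].
- by rewrite cT.
- by rewrite cT.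
- by apply/eqP; rewrite eqn_leq lb (leq_trans le ub).
- by apply/eqP; rewrite eqn_leq ub (leq_trans lb le).
Qed.
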